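(* Let $\mathfrak{H}$ and $\mathfrak{K}_n$, $n\in\mathbb{N}$, be Hilbert spaces and let $T_n\in\mathbf{L}(\mathfrak{H},\mathfrak{K}_n)$ be a sequence of linear operators with $T_m\prec_c T_n$ for $m\le n$. Let $T\in\mathbf{L}(\mathfrak{H},\mathfrak{K})$, where $\mathfrak{K}$ is a Hilbert space, be a limit of the sequence $T_n$. If $T'\in\mathbf{L}(\mathfrak{H},\mathfrak{K}')$, where $\mathfrak{K}'$ is a Hilbert space, is another limit of the sequence $T_n$ with $\operatorname{dom}T'=\operatorname{dom}T$, then there exists a partial isometry $V\in\mathbf{B}(\mathfrak{K},\mathfrak{K}')$ with initial space $\overline{\operatorname{ran}}\,T$ and final space $\overline{\operatorname{ran}}\,T'$ such that $T'=VT$.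
   Context: $\mathbf{L}(\mathfrak{H},\mathfrak{K})$ denotes the class of all linear relations from the Hilbert space $\mathfrak{H}$ to the Hilbert space $\mathfrak{K}$, i.e. all linear subspaces of $\mathfrak{H}\times\mathfrak{K}$; a linear operator is a linear relation $T$ with $\{f':\{0,f'\}\in T\}=\{0\}$. Operators are defined on a linear subspace $\operatorname{dom}T$ which need not be dense and need not be bounded. $\mathbf{B}(\mathfrak{K},\mathfrak{K}')$ denotes the bounded everywhere defined operators. For linear operators $A\in\mathbf{L}(\mathfrak{H},\mathfrak{H}_A)$ and $B\in\mathbf{L}(\mathfrak{H},\mathfrak{H}_B)$, $A\prec_c B$ means that there is a contraction $C\in\mathbf{B}(\mathfrak{H}_B,\mathfrak{H}_A)$ with $CB\subset A$; equivalently $\operatorname{dom}B\subset\operatorname{dom}A$ and $\|Af\|\le\|Bf\|$ for all $f\in\operatorname{dom}B$. A limit of the sequence $T_n$ is a linear operator $T$ from $\mathfrak{H}$ to some Hilbert space such that $\operatorname{dom} T=\{\varphi\in\bigcap_{n}\operatorname{dom}T_n:\sup_{n}\|T_n\varphi\|<\infty\}$, $T_n\prec_c T$ for all $n$, and $\|T_n\varphi\|\nearrow\|T\varphi\|$ (nondecreasing convergence) for all $\varphi\in\operatorname{dom}T$. *)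

(* Defs.v *)
From HB Require Import structures.
From mathcomp Require Import all_boot all_order all_algebra.
From mathcomp Require Import complex.
From mathcomp Require Import all_classical all_reals all_analysis.

Set Implicit Arguments.
Unset Strict Implicit.
Unset Printing Implicit Defensive.

Import Order.TTheory GRing.Theory Num.Theory.
Import numFieldNormedType.Exports.

Local Open Scope classical_set_scope.
Local Open Scope ring_scope.

(* Hilbert spaces are over the reals or over the complex numbers. *)
Variant scalars := Real | Complex.

Definition scalar_field (R : realType) (s : scalars) : numFieldType :=
  match s with Real => R | Complex => R[i] end.

Definition scalar_conj (R : realType) (s : scalars) :
    scalar_field R s -> scalar_field R s :=
  match s with Real => idfun | Complex => Num.conj end.

(* The inner product is linear in its first argument and theta-semilinear in
   its second one. Norms take their values in K itself; for K = R[i] they are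
   nonnegative in the partial order of R[i], hence real. *)
HB.mixin Record isHilbert (K : numFieldType) (theta : K -> K) H
    & CompleteNormedModule K H := {
  inner : {dot H for theta} ;
  inner_normE : forall x : H, inner x x = `|x| ^+ 2
}.

#[short(type="hilbertType")]
HB.structure Definition Hilbert (K : numFieldType) (theta : K -> K) :=
  { H of CompleteNormedModule K H & isHilbert K theta H }.

Section LinearRelations.
Context {K : numFieldType} {theta : K -> K}.
Implicit Types H G : hilbertType theta.

Record linear_relation H G := LinearRelation {
  graph :> set (H * G) ;
  graph_submod : submod_closed (mem graph)
}.

Definition dom H G (T : linear_relation H G) : set H := fst @` T.

Definition ran H G (T : linear_relation H G) : set G := snd @` T.

Definition is_operator H G (T : linear_relation H G) : Prop :=
  [set g | graph T (0, g)] = [set 0].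

(* The value T f of an operator T, with junk value 0 outside dom T. *)
Definition app H G (T : linear_relation H G) (f : H) : G :=
  xget 0 [set g | graph T (f, g)].

Definition bounded_op H G (V : H -> G) : Prop :=
  exists M : K, forall x, `|V x| <= M * `|x|.

Definition contraction H G (C : H -> G) : Prop := forall x, `|C x| <= `|x|.

(* The product C B of relations, where C is everywhere defined. *)
Definition opmul H G G' (C : G -> G') (B : linear_relation H G) :
    set (H * G') :=
  [set (p.1, C p.2) | p in B].

Definition prec_c H G G' (A : linear_relation H G) (B : linear_relation H G')
    : Prop :=
  exists C : {linear G' -> G}, contraction C /\ opmul C B `<=` A.

Definition is_limit H (G : nat -> hilbertType theta)
    (Tn : forall n, linear_relation H (G n)) (G' : hilbertType theta)
    (T : linear_relation H G') : Prop :=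
  [/\ is_operator T,
      dom T = [set phi | (\bigcap_n dom (Tn n)) phi /\
                         has_ubound (range (fun n => `|app (Tn n) phi|))],
      forall n, prec_c (Tn n) T
    & forall phi, dom T phi ->
        nondecreasing_seq (fun n => `|app (Tn n) phi|) /\
        `|app (Tn n) phi| @[n --> \oo] --> `|app T phi| ].

Definition orthocompl H (A : set H) : set H :=
  [set x | forall y, A y -> inner x y = 0].

Definition initial_space H G (V : H -> G) : set H :=
  orthocompl [set x | V x = 0].

Definition final_space H G (V : H -> G) : set G := range V.

Definition partial_isometry H G (V : H -> G) : Prop :=
  forall x, initial_space V x -> `|V x| = `|x|.

End LinearRelations.

(* Main.v *)
From HB Require Import structures.
Require Import Defs.
From mathcomp Require Import all_boot all_order all_algebra.
From mathcomp Require Import complex ring.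
From mathcomp Require Import all_classical all_reals all_analysis.
Import Order.TTheory GRing.Theory Num.Theory.
Import numFieldNormedType.Exports.
Set Implicit Arguments.
Unset Strict Implicit.
Unset Printing Implicit Defensive.
Local Open Scope classical_set_scope.
Local Open Scope ring_scope.

(** For [f] in the common domain of [T] and [T'], the norms of [T f] and [T' f]
    are both the limit of the norms of [Tn n f], hence equal
    ([limits_same_norm]). Therefore the pairs [(T f, T' f)] form a linear
    relation [G] between [K] and [K'] that preserves norms, with domain [ran T]
    and range [ran T'].

    Such a relation always extends to a partial isometry
    ([partial_isometry_extension]). By completeness, its closure is the graph
    of a surjective isometry from the closure of [ran T] onto the closure of
    [ran T'] ([isometry_extend], [isometry_extend_snd]). Composing it with the
    orthogonal projection on the closure of [ran T] ([orthogonal_projection])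
    gives [V], whose kernel is the orthogonal complement of [ran T], so that
    its initial space is the closure of [ran T].

    The projection comes from the classical argument that minimizes the
    distance to a subspace. Since the norm takes its values in the scalar
    field, which may be R[i] with its partial order, the infimum is obtained
    through the real parts ([scalar_inf]). *)

(** * Scalars *)

(** Stated for both fields at once, so that the computations with inner products
    do not have to distinguish the real from the complex case. *)
Lemma mul_scalar_conj (R : realType) (s : scalars) (a : scalar_field R s) :
  a * scalar_conj a = `|a| ^+ 2.
Proof.
case: s a => a /=; last by rewrite normCK.
by rewrite -expr2 real_normK// num_real.
Qed.

(** Norms of a complex Hilbert space are elements of R[i], whose order is only
    partial, so its completeness cannot be invoked directly. Nonnegative
    elements of R[i] are real, and the infimum is taken on their real parts. *)
Lemma scalar_inf (R : realType) (s : scalars) (A : set (scalar_field R s)) :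
  A !=set0 -> (forall a, A a -> 0 <= a) ->
  exists d, (forall a, A a -> d <= a) /\
    (forall e, 0 < e -> exists2 a, A a & a < d + e).
Proof.
case: s A => /= A [a0 Aa0] A_ge0.
  have infA : has_inf A by split; [exists a0 | exists 0 => a /A_ge0].
  exists (inf A); split=> [a Aa|e e0]; first exact: ge_inf infA.2 _ Aa.
  exact: inf_adherent.
pose B : set R := [set complex.Re a | a in A].
have ReK a : A a -> a = real_complex R (complex.Re a).
  by move=> /A_ge0/ger0_real/RRe_real.
have infB : has_inf B.
  split; first by exists (complex.Re a0); exists a0.
  by exists 0 => _ [a Aa <-]; have := A_ge0 _ Aa; rewrite {1}(ReK a Aa) ler0c.
exists (real_complex R (inf B)); split=> [a Aa|e e0].
  by rewrite (ReK a Aa) lecR; apply: ge_inf infB.2 _ _; exists a.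
have eE : e = real_complex R (complex.Re e).
  by rewrite RRe_real// gtr0_real.
have : 0 < complex.Re e by rewrite -ltcR -eE.
move=> /inf_adherent/(_ infB)[_ [a Aa <-] ltae]; exists a => //.
by rewrite (ReK a Aa) eE -rmorphD ltcR.
Qed.

Lemma eq0_le_eps (F : numFieldType) (x y : F) :
  0 <= x -> 0 <= y -> (forall e, 0 < e -> x <= e * y) -> x = 0.
Proof.
move=> x0 y0 xey; apply/eqP; rewrite eq_le x0 andbT; apply/ler_addgt0Pr => e e0.
have y1 : 0 < y + 1 by rewrite ltr_wpDl.
(* [y] may vanish, hence the division by [y + 1]. *)
rewrite add0r (le_trans (xey (e / (y + 1)) _)) ?divr_gt0//.
by rewrite mulrAC ler_pdivrMr// ler_pM2l// lerDl.
Qed.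

(** * Closures and completeness in normed modules *)

Lemma closure_ballP (K : numFieldType) (T : pseudoMetricType K) (A : set T) x :
  closure A x <-> forall e : K, 0 < e -> exists2 y, A y & ball x e y.
Proof.
split=> [Ax e e0|Ax B /nbhs_ballP[e /= e0 eB]].
  by have [y [Ay xy]] := Ax _ (nbhsx_ballx x e e0); exists y.
by have [y Ay xy] := Ax e e0; exists y; split=> //; exact: eB.
Qed.

(** Cantor's intersection principle. It replaces Cauchy sequences: the sets
    are indexed by the positive scalars themselves, so that no sequence of
    almost-minimizers or of approximations has to be chosen. *)
Lemma cauchy_family (K : numFieldType) (E : completeNormedModType K)
    (A : K -> set E) :
  (forall e, 0 < e -> A e !=set0) ->
  (forall e e', 0 < e -> e <= e' -> A e `<=` A e') ->
  (forall e, 0 < e -> exists2 d, 0 < d &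
     forall y z, A d y -> A d z -> `|y - z| < e) ->
  exists u, forall e, 0 < e -> exists2 y, A e y & `|u - y| < e.
Proof.
move=> A_neq0 A_incr A_small.
pose F := filter_from [set e : K | 0 < e] A.
have FF : ProperFilter F.
  apply: filter_from_proper => //.
  apply: filter_from_filter; first by exists 1 => /=.
  move=> e e' /= e0 e'0.
  have [le_ee'|/ltW le_e'e] := real_leP (gtr0_real e0) (gtr0_real e'0).
    by exists e => // y Ay; split=> //; exact: A_incr Ay.
  by exists e' => // y Ay; split=> //; exact: A_incr Ay.
have /cauchy_cvg/cvg_ex[u Fu] : cauchy F.
  apply: cauchy_exP => e e0; have [d d0 Ad] := A_small _ e0.
  have [y Ay] := A_neq0 _ d0; exists y; exists d => // z Az.
  by rewrite -ball_normE /=; exact: Ad.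
exists u => e e0.
have /Fu [d /= d0 Ad] : nbhs u (ball u e) by exact: nbhsx_ballx.
(* A point of the smaller of [A e] and [A d] lies in both. *)
have [le_ed|/ltW le_de] := real_leP (gtr0_real e0) (gtr0_real d0).
  have [y Ay] := A_neq0 _ e0; exists y => //.
  by have := Ad y (A_incr _ _ e0 le_ed _ Ay); rewrite -ball_normE.
have [y Ay] := A_neq0 _ d0; exists y; first exact: A_incr Ay.
by have := Ad y Ay; rewrite -ball_normE.
Qed.

(** Pointwise on a classical set, rather than on a boolean predicate, because it
    is applied to images and closures, whose membership is a proposition. *)
Definition linear_subset (F : numFieldType) (E : lmodType F) (D : set E) :=
  D 0 /\ forall a u v, D u -> D v -> D (a *: u + v).

(** Addition and scaling are continuous; an error of [e / 2 / (|a| + 1)] on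
    [u] costs at most [e / 2] after scaling by [a]. *)
Lemma closure_linear_subset (F : numFieldType) (E : normedModType F)
    (D : set E) :
  linear_subset D -> linear_subset (closure D).
Proof.
move=> [D0 DP]; split; first exact: subset_closure.
move=> a u v /closure_ballP Du /closure_ballP Dv; apply/closure_ballP => e e0.
have a1 : 0 < `|a| + 1 by rewrite ltr_wpDl.
have [|u' Du'] := Du (e / 2%:R / (`|a| + 1)); first by rewrite !divr_gt0.
have [|v' Dv'] := Dv (e / 2%:R); first by rewrite divr_gt0.
rewrite -!ball_normE /= => vv' uu'; exists (a *: u' + v'); first exact: DP.
rewrite /= opprD addrACA -scalerBr [e]splitr (le_lt_trans (ler_normD _ _))//.
rewrite ler_ltD// normrZ (le_trans (ler_wpM2l _ (ltW uu')))//.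
by rewrite mulrCA ger_pMr ?divr_gt0// ler_pdivrMr// mul1r lerDl.
Qed.

Lemma closure_fst (F : numFieldType) (E E' : normedModType F)
    (G : set (E * E')) p :
  closure G p -> closure (fst @` G) p.1.
Proof.
move=> /closure_ballP Gp; apply/closure_ballP => e /Gp[q Gq [pq _]].
by exists q.1 => //; exists q.
Qed.

Lemma closure_snd (F : numFieldType) (E E' : normedModType F)
    (G : set (E * E')) p :
  closure G p -> closure (snd @` G) p.2.
Proof.
move=> /closure_ballP Gp; apply/closure_ballP => e /Gp[q Gq [_ pq]].
by exists q.2 => //; exists q.
Qed.

Lemma closure_isometry (F : numFieldType) (E E' : normedModType F)
    (G : set (E * E')) :
  (forall p, G p -> `|p.2| = `|p.1|) ->
  forall p, closure G p -> `|p.2| = `|p.1|.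
Proof.
move=> Giso [u v] /closure_ballP Guv /=.
apply/eqP; rewrite -subr_eq0; apply/eqP/normr0_eq0.
apply/(@eq0_le_eps _ _ 2%:R) => // e e0; have [[u' v'] G'] := Guv e e0.
have /= vu' := Giso _ G'.
case=> /=; rewrite -!ball_normE /= => uu' vv'.
rewrite -(subrKA `|v'|) [in X in _ + X]vu' (le_trans (ler_normD _ _))//.
rewrite mulr_natr mulr2n lerD//.
  exact: le_trans (ler_dist_dist _ _) (ltW vv').
by rewrite distrC in uu'; exact: le_trans (ler_dist_dist _ _) (ltW uu').
Qed.

(** The second components of the points of [G] whose first components approach
    [u] form a Cauchy family, because [G] preserves distances: this is the
    extension of an isometry by continuity. *)
Lemma isometry_extend (F : numFieldType) (E : normedModType F)
    (E' : completeNormedModType F) (G : set (E * E')) (u : E) :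
  linear_subset G ->
  (forall p, G p -> `|p.2| = `|p.1|) ->
  closure (fst @` G) u -> exists v, closure G (u, v).
Proof.
move=> [_ GP] Giso /closure_ballP Gu.
pose A e := [set v | exists2 u', G (u', v) & `|u - u'| < e].
have [|e e' e0 ee' v [u' Gv uu']|e e0|v Av] := @cauchy_family _ _ A.
- move=> e /Gu[_ [[u' v] Gv <-]]; rewrite -ball_normE => uu'.
  by exists v, u'.
- by exists u' => //; exact: lt_le_trans ee'.
- exists (e / 2%:R); first by rewrite divr_gt0.
  move=> v1 v2 [u1 G1 uu1] [u2 G2 uu2].
  have := GP (-1) _ _ G2 G1; rewrite scaleN1r addrC => /Giso /= ->.
  rewrite -(subrKA u) [e]splitr (le_lt_trans (ler_normD _ _))// ltrD//.
  by rewrite distrC.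
exists v; apply/closure_ballP => e e0.
have [v' [u' G' uu'] vv'] := Av e e0; exists (u', v') => //.
by split; rewrite -ball_normE.
Qed.

(** The hypotheses on [G] are symmetric under exchange of the two components. *)
Lemma isometry_extend_snd (F : numFieldType)
    (E : completeNormedModType F) (E' : normedModType F) (G : set (E * E'))
    (v : E') :
  linear_subset G ->
  (forall p, G p -> `|p.2| = `|p.1|) ->
  closure (snd @` G) v -> exists u, closure G (u, v).
Proof.
move=> [G0 GP] Giso Gv; pose G' := [set p : E' * E | G (p.2, p.1)].
have [u /closure_ballP G'vu] : exists u, closure G' (v, u).
  apply: isometry_extend.
  - by split=> // a [? ?] [? ?]; exact: GP.
  - by move=> [? ?] /Giso.
  - move: Gv; congr (closure _ v).
    by apply/seteqP; split=> [_ [[a b] ? <-]|_ [[a b] ? <-]]; exists (b, a).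
exists u; apply/closure_ballP => e /G'vu[[a b] Gba [? ?]].
by exists (b, a).
Qed.

(** * Geometry of Hilbert spaces *)

Section HilbertSpaces.
Context {R : realType} {s : scalars}.
Local Notation scalar := (scalar_field R s).
Implicit Types H K : hilbertType (@scalar_conj R s).

Lemma innerDl H (x y z : H) : inner (x + y) z = inner x z + inner y z.
Proof. exact: linearDl. Qed.

Lemma innerDr H (x y z : H) : inner x (y + z) = inner x y + inner x z.
Proof. exact: linearDr. Qed.

Lemma innerZl H a (x y : H) : inner (a *: x) y = a * inner x y.
Proof. exact: linearZl_LR. Qed.

Lemma innerZr H a (x y : H) : inner x (a *: y) = scalar_conj a * inner x y.
Proof. exact: linearZr_LR. Qed.

Lemma innerNl H (x y : H) : inner (- x) y = - inner x y.
Proof. exact: linearNl. Qed.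

Lemma innerNr H (x y : H) : inner x (- y) = - inner x y.
Proof. exact: linearNr. Qed.

Lemma inner0l H (x : H) : inner 0 x = 0.
Proof. exact: linear0l. Qed.

Lemma inner0r H (x : H) : inner x 0 = 0.
Proof. exact: linear0r. Qed.

Lemma innerC H (x y : H) : inner y x = scalar_conj (inner x y).
Proof. by rewrite hermitian_subproof expr0 mul1r. Qed.

Lemma inner_orthC H (x y : H) : inner x y = 0 -> inner y x = 0.
Proof.
by move=> xy0; rewrite innerC xy0; case: (s) => /=; rewrite ?rmorph0.
Qed.

Lemma pythagoras H (x y : H) :
  inner x y = 0 -> `|x + y| ^+ 2 = `|x| ^+ 2 + `|y| ^+ 2.
Proof.
move=> xy0; rewrite -!inner_normE innerDl !innerDr xy0 (inner_orthC xy0).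
by rewrite addr0 add0r.
Qed.

Lemma parallelogram H (x y : H) :
  `|x + y| ^+ 2 + `|x - y| ^+ 2 = `|x| ^+ 2 *+ 2 + `|y| ^+ 2 *+ 2.
Proof.
by rewrite -!inner_normE !(innerDl, innerDr, innerNl, innerNr); ring.
Qed.

(** Removing from [x] its component along [y]. For [y = 0] the identity holds
    because the division by zero then gives zero. *)
Lemma norm_sub_component H (x y : H) : exists c : scalar,
  `|x - c *: y| ^+ 2 = `|x| ^+ 2 - `|inner x y| ^+ 2 / `|y| ^+ 2.
Proof.
have [->|y0] := eqVneq y 0.
  by exists 0; rewrite scale0r subr0 inner0r normr0 expr0n mul0r subr0.
have n0 : `|y| ^+ 2 != 0 by rewrite expf_neq0// normr_eq0.
(* [c *: y] is the orthogonal projection of [x] on the line of [y]. *)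
pose a := inner x y; pose c := a / `|y| ^+ 2; exists c.
have aE : a = c * `|y| ^+ 2 by rewrite divfK.
have normaE : `|a| ^+ 2 / `|y| ^+ 2 = `|c| ^+ 2 * `|y| ^+ 2.
  rewrite aE normrM exprMn normrX normr_id.
  by rewrite -mulrA (expr2 (`|y| ^+ 2)) mulfK.
have ca : scalar_conj c * a = `|c| ^+ 2 * `|y| ^+ 2.
  by rewrite aE mulrA [_ * c]mulrC mul_scalar_conj.
have ac : c * scalar_conj a = `|c| ^+ 2 * `|y| ^+ 2.
  by rewrite /c mulrAC mul_scalar_conj normaE.
rewrite -[LHS]inner_normE.
rewrite !(innerDl, innerDr, innerNl, innerNr, innerZl, innerZr).
rewrite !inner_normE (innerC x y) -/a ca ac normaE.
by rewrite (mulrA c) mul_scalar_conj subrr addr0.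
Qed.

(** If moving [x] along [y] can lower its squared norm by at most [e ^+ 2],
    then [x] is nearly orthogonal to [y]. With [e = |x|] the hypothesis is
    trivial and this is the Cauchy-Schwarz inequality; with a small [e] it
    turns near-minimality of a distance into near-orthogonality. *)
Lemma inner_le H (x y : H) (e : scalar) : 0 <= e ->
  (forall c : scalar, `|x| ^+ 2 - e ^+ 2 <= `|x - c *: y| ^+ 2) ->
  `|inner x y| <= e * `|y|.
Proof.
move=> e0 le_xe; have [->|y0] := eqVneq y 0.
  by rewrite inner0r !normr0 mulr0.
have y2 : 0 < `|y| ^+ 2 by rewrite exprn_gt0// normr_gt0.
have [c xcy] := norm_sub_component x y.
have := le_xe c; rewrite xcy lerD2l lerN2 ler_pdivrMr// -exprMn.
by rewrite ler_pXn2r// nnegrE// mulr_ge0.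
Qed.

Lemma cauchy_schwarz H (x y : H) : `|inner x y| <= `|x| * `|y|.
Proof. by apply: inner_le => // c; rewrite subrr exprn_ge0. Qed.

(** Continuity of the inner product in its second argument. *)
Lemma orth_closure H (D : set H) (x y : H) :
  orthocompl D x -> closure D y -> inner x y = 0.
Proof.
move=> Dx /closure_ballP Dy; apply/normr0_eq0/(@eq0_le_eps _ _ `|x|) => // e e0.
have [z Dz] := Dy e e0; rewrite -ball_normE /= => /ltW yz.
rewrite -(subrK z y) innerDr (Dx z Dz) addr0 (le_trans (cauchy_schwarz _ _))//.
by rewrite mulrC ler_wpM2r.
Qed.

(** Let [d] be the infimum of [|x - y| ^+ 2] over [D]. By the parallelogram
    identity, points of [D] that nearly realize [d] are close to each other,
    so they accumulate at some [u]. Orthogonality of [x - u] to [D] is read off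
    from the near-minimizers [y], for which [x - y] is nearly orthogonal to
    [D], and passes to [u] by Cauchy-Schwarz. *)
Lemma orthogonal_projection H (D : set H) (x : H) : linear_subset D ->
  exists2 u, closure D u & orthocompl D (x - u).
Proof.
move=> [D0 DP].
have [d [dle dlt]] : exists d : scalar,
    [/\ forall y, D y -> d <= `|x - y| ^+ 2
      & forall e, 0 < e -> exists2 y, D y & `|x - y| ^+ 2 < d + e].
  have [||d [dle dlt]] := @scalar_inf R s [set `|x - y| ^+ 2 | y in D].
  - by exists (`|x - 0| ^+ 2), 0.
  - by move=> _ [y Dy <-]; rewrite exprn_ge0.
  exists d; split=> [y Dy|e e0]; first by apply: dle; exists y.
  by have [_ [y Dy <-] ?] := dlt e e0; exists y.
pose A e := [set y | D y /\ `|x - y| ^+ 2 < d + e ^+ 2].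
have [|e e' e0 ee' y [Dy xy]|e e0|u Au] := @cauchy_family _ _ A.
- move=> e e0; have [|y Dy xy] := dlt (e ^+ 2); first by rewrite exprn_gt0.
  by exists y.
- split=> //; rewrite (lt_le_trans xy)// lerD2l lerXn2r// nnegrE ltW//.
  exact: lt_le_trans ee'.
(* The factor 4 that the parallelogram identity yields is absorbed by
   [(e / 2) ^+ 2]. *)
- exists (e / 2%:R); first by rewrite divr_gt0.
  move=> y z [Dy xy] [Dz xz].
  (* The midpoint is in [D], hence not closer to [x] than [d]. *)
  have Dyz : D (2%:R^-1 *: (y + z)).
    rewrite scalerDr -[_ *: z]addr0.
    exact: DP _ _ _ Dy (DP _ _ _ Dz D0).
  have sumE : (x - y) + (x - z) = 2%:R *: (x - 2%:R^-1 *: (y + z)).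
    rewrite scalerBr scalerA divff// scale1r scaler_nat mulr2n opprD.
    by rewrite addrACA.
  have diffE : (x - y) - (x - z) = z - y by rewrite opprB addrC subrKA.
  have := parallelogram (x - y) (x - z).
  rewrite sumE diffE normrZ exprMn normr_nat (distrC z) => pl.
  have : `|y - z| ^+ 2 < e ^+ 2.
    have -> : `|y - z| ^+ 2 = `|x - y| ^+ 2 *+ 2 + `|x - z| ^+ 2 *+ 2 -
       2%:R ^+ 2 * `|x - 2%:R^-1 *: (y + z)| ^+ 2 by rewrite -pl; ring.
    have -> : e ^+ 2 = (d + (e / 2%:R) ^+ 2) *+ 2 + (d + (e / 2%:R) ^+ 2) *+ 2
       - 2%:R ^+ 2 * d by field.
    rewrite ltr_leD ?ltrD ?ltrMn2r ?xy ?xz//.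
    by rewrite lerN2 ler_pM2l ?exprn_gt0// dle.
  by rewrite ltr_pXn2r// nnegrE// ltW.
exists u.
  apply/closure_ballP => e /Au[y [Dy _] uy]; exists y => //.
  by rewrite -ball_normE.
move=> m Dm; apply/normr0_eq0/(@eq0_le_eps _ _ (`|m| *+ 2)) => [//||e e0].
  by rewrite mulrn_wge0.
have [y [Dy xy] uy] := Au e e0.
(* [x - u = (x - y) + (y - u)] with [y] a near-minimizer close to [u]. *)
rewrite mulrnAr mulr2n -(subrK y x) -addrA innerDl (le_trans (ler_normD _ _))//.
apply: lerD; last first.
  by rewrite (le_trans (cauchy_schwarz _ _))// distrC ler_wpM2r// ltW.
apply: inner_le => [|c]; first exact: ltW.
have -> : x - y - c *: m = x - (c *: m + y) by rewrite opprD addrA addrAC.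
rewrite (@le_trans _ _ d)//; last by apply: dle; exact: DP.
by rewrite lerBlDr ltW.
Qed.

(** * Extension of an isometric relation to a partial isometry *)

(** The closure of [G] is the graph of a surjective isometry between the two
    closed ranges, and [V x] is its value at the orthogonal projection of [x].
    As a relation, [V] pairs [x] with [v] when some [u] satisfies
    [closure G (u, v)] and [x - u] is orthogonal to the first components of
    [G]. In this form linearity is immediate, and single-valuedness reduces to
    [x = 0], where [u] lies in a closed subspace and is orthogonal to it. *)
Theorem partial_isometry_extension H K (G : set (H * K)) : linear_subset G ->
  (forall p, G p -> `|p.2| = `|p.1|) ->
  exists V : {linear H -> K},
    [/\ forall p, G p -> V p.1 = p.2,
        forall x, `|V x| <= `|x|,
        partial_isometry V,
        initial_space V = closure (fst @` G)
      & final_space V = closure (snd @` G)].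
Proof.
move=> G_sub G_iso; pose D := fst @` G.
have D_sub : linear_subset D.
  have [G0 GP] := G_sub; split; first by exists 0.
  by move=> a _ _ [p Gp <-] [q Gq <-]; exists (a *: p + q) => //; exact: GP.
have [cG0 cGP] := closure_linear_subset G_sub.
have cG_iso := closure_isometry G_iso.
pose Vrel x v := exists2 u, closure G (u, v) & orthocompl D (x - u).
have Vrel_ex x : exists v, Vrel x v.
  have [u Du xu] := orthogonal_projection x D_sub.
  by have [v Guv] := isometry_extend G_sub G_iso Du; exists v, u.
have VrelP a x y v w : Vrel x v -> Vrel y w -> Vrel (a *: x + y) (a *: v + w).
  move=> [u Guv xu] [t Gtw yt]; exists (a *: u + t); first exact: cGP Guv Gtw.
  move=> z Dz; rewrite opprD addrACA -scalerBr innerDl innerZl.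
  by rewrite xu// yt// mulr0 addr0.
have Vrel0 v : Vrel 0 v -> v = 0.
  move=> [u Guv u_orth]; apply: normr0_eq0; rewrite (cG_iso _ Guv) /=.
  have := orth_closure u_orth (closure_fst Guv).
  rewrite sub0r innerNl inner_normE => /eqP.
  by rewrite oppr_eq0 sqrf_eq0 => /eqP.
have Vrel_fun x v w : Vrel x v -> Vrel x w -> v = w.
  move=> xv xw; have := VrelP (-1) _ _ _ _ xw xv.
  by rewrite !scaleN1r addNr addrC => /Vrel0 /subr0_eq.
have [f fP] := choice Vrel_ex.
have f_lin : linear f.
  by move=> a x y; apply: Vrel_fun (fP _) (VrelP _ _ _ _ _ (fP x) (fP y)).
pose V : {linear H -> K} := HB.pack f (GRing.isLinear.Build _ _ _ _ f f_lin).
have VE x v : Vrel x v -> V x = v by move=> xv; apply: Vrel_fun (fP x) xv.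
have V_graph u v : closure G (u, v) -> V u = v.
  by move=> Guv; apply: VE; exists u => // z _; rewrite subrr inner0l.
have V_ker x : orthocompl D x -> V x = 0.
  by move=> Dx; apply: VE; exists 0; rewrite ?subr0.
have V_decomp x : exists u w,
    [/\ x = u + w, closure G (u, V x), orthocompl D w & inner u w = 0].
  have [u Guv xu] := fP x; exists u, (x - u).
  split=> //; first by rewrite subrKC.
  exact: inner_orthC (orth_closure xu (closure_fst Guv)).
have initialE : initial_space V = closure D.
  apply/seteqP; split=> [x x_init|x Dx y Vy0].
    have [u [w [xE Guv w_orth uw0]]] := V_decomp x.
    have : inner x w = 0 by apply: x_init; exact: V_ker.
    rewrite xE innerDl uw0 add0r inner_normE => /eqP.
    rewrite sqrf_eq0 normr_eq0 => /eqP->; rewrite addr0.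
    exact: closure_fst Guv.
  have [u [w [yE Guv w_orth uw0]]] := V_decomp y.
  move: Guv; rewrite Vy0 => /cG_iso /= /esym; rewrite normr0 => /normr0_eq0 u0.
  by rewrite yE u0 add0r; exact: inner_orthC (orth_closure w_orth Dx).
exists V; split=> //.
- move=> [u v] Guv; apply: V_graph; exact: subset_closure.
- move=> x; have [u [w [xE Guv w_orth uw0]]] := V_decomp x.
  rewrite (cG_iso _ Guv) /= -(@ler_pXn2r _ 2) ?nnegrE// xE.
  by rewrite pythagoras// lerDl exprn_ge0.
- move=> x; rewrite initialE => Dx.
  have [v Gxv] := isometry_extend G_sub G_iso Dx.
  by rewrite (V_graph _ _ Gxv) (cG_iso _ Gxv).
apply/seteqP; split=> [_ [x _ <-]|v Gv].
  have [u [w [_ Guv _ _]]] := V_decomp x; exact: closure_snd Guv.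
have [u Guv] := isometry_extend_snd G_sub G_iso Gv.
by exists u => //; exact: V_graph.
Qed.

End HilbertSpaces.

(** * Limits of a sequence of operators *)

Lemma graph_linear_subset (F : numFieldType) (theta : F -> F)
    (H K : hilbertType theta) (T : linear_relation H K) :
  linear_subset (graph T).
Proof.
have [T0 TP] := graph_submod T; split; first exact: set_mem T0.
by move=> a p q Tp Tq; exact: set_mem (TP a p q (mem_set Tp) (mem_set Tq)).
Qed.

(** Two values at [f] differ by a value at [0], which must be [0]. *)
Lemma app_graph (F : numFieldType) (theta : F -> F) (H K : hilbertType theta)
    (T : linear_relation H K) f g :
  is_operator T -> graph T (f, g) -> app T f = g.
Proof.
move=> Top Tfg; apply: xget_unique => // g' /= Tfg'.
have := (graph_linear_subset T).2 (-1) _ _ Tfg Tfg'.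
rewrite scaleN1r addrC.
have -> : (f, g') - (f, g) = (0, g' - g).
  by rewrite -[LHS]/(f - f, g' - g) subrr.
move=> T0gg'.
have : [set h | graph T (0, h)] (g' - g) by [].
by rewrite Top => /subr0_eq.
Qed.

(** Both norms are the limit of the same scalar sequence. *)
Lemma limits_same_norm (F : numFieldType) (theta : F -> F)
    (H : hilbertType theta) (Kn : nat -> hilbertType theta)
    (Tn : forall n, linear_relation H (Kn n)) (K K' : hilbertType theta)
    (T : linear_relation H K) (T' : linear_relation H K') f k k' :
  is_limit Tn T -> is_limit Tn T' -> graph T (f, k) -> graph T' (f, k') ->
  `|k'| = `|k|.
Proof.
move=> [Top _ _ Tlim] [T'op _ _ T'lim] Tfk T'fk'.
rewrite -(app_graph Top Tfk) -(app_graph T'op T'fk').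
have [_ lim_T] : _ /\ _ := Tlim f (ex_intro2 _ _ _ Tfk erefl).
have [_ lim_T'] : _ /\ _ := T'lim f (ex_intro2 _ _ _ T'fk' erefl).
exact: cvg_unique lim_T' lim_T.
Qed.

Theorem corollary5p2 (R : realType) (s : scalars)
    (H : hilbertType (@scalar_conj R s))
    (Kn : nat -> hilbertType (@scalar_conj R s))
    (Tn : forall n, linear_relation H (Kn n))
    (Tn_op : forall n, is_operator (Tn n))
    (Tn_mono : forall m n, (m <= n)%N -> prec_c (Tn m) (Tn n))
    (K : hilbertType (@scalar_conj R s)) (T : linear_relation H K)
    (T_limit : is_limit Tn T)
    (K' : hilbertType (@scalar_conj R s)) (T' : linear_relation H K')
    (T'_limit : is_limit Tn T')
    (domT' : dom T' = dom T) :
  exists V : {linear K -> K'},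
    [/\ bounded_op V,
        partial_isometry V,
        initial_space V = closure (ran T),
        final_space V = closure (ran T')
      & graph T' = opmul V T].
Proof.
have domE f : (exists k, graph T (f, k)) <-> (exists k', graph T' (f, k')).
  split=> -[k Tfk].
    have : dom T f by exists (f, k).
    by rewrite -domT' => -[[g k'] T'gk' /= <-]; exists k'.
  have : dom T' f by exists (f, k).
  by rewrite domT' => -[[g k'] T'gk' /= <-]; exists k'.
(* The relation [T' T^-1], with domain all of [ran T] as [dom T' = dom T]. *)
pose G : set (K * K') :=
  [set p | exists f, graph T (f, p.1) /\ graph T' (f, p.2)].
have G_sub : linear_subset G.
  have [T0 TP] := graph_linear_subset T.
  have [T'0 T'P] := graph_linear_subset T'.
  split; first by exists 0.
  move=> a p q [f [Tp T'p]] [g [Tq T'q]]; exists (a *: f + g).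
  by split; [exact: TP Tp Tq | exact: T'P T'p T'q].
have G_iso p : G p -> `|p.2| = `|p.1|.
  by move=> [f [Tp T'p]]; exact: limits_same_norm T_limit T'_limit Tp T'p.
have ranTE : fst @` G = ran T.
  apply/seteqP; split=> [_ [[k k'] [f [Tfk _]] <-]|_ [[f k] Tfk <-]] /=.
    by exists (f, k).
  have [k' T'fk'] := (domE f).1 (ex_intro _ k Tfk).
  by exists (k, k') => //; exists f.
have ranT'E : snd @` G = ran T'.
  apply/seteqP; split=> [_ [[k k'] [f [_ T'fk']] <-]|_ [[f k'] T'fk' <-]] /=.
    by exists (f, k').
  have [k Tfk] := (domE f).2 (ex_intro _ k' T'fk').
  by exists (k, k') => //; exists f.
have [V [VG V_contr V_iso V_init V_fin]] :=
  partial_isometry_extension G_sub G_iso.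
exists V; split=> //.
- by exists 1 => x; rewrite mul1r.
- by rewrite V_init ranTE.
- by rewrite V_fin ranT'E.
apply/seteqP; split=> [[f k'] T'fk'|_ [[f k] Tfk <-]] /=.
  have [k Tfk] := (domE f).2 (ex_intro _ k' T'fk'); exists (f, k) => //=.
  by rewrite (VG (k, k'))//; exists f.
have [k' T'fk'] := (domE f).1 (ex_intro _ k Tfk).
by rewrite (VG (k, k'))//; exists f.
Qed.
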